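(* Let $m\ge 2$ be an integer, $q=m^2$, $l=8$, and identify $\mathbb{R}^8$ with the space $M_2(\mathbb{C})$ of complex $2\times 2$ matrices and the index set $\{1,\dots,q\}$ with $(\mathbb{Z}/m\mathbb{Z})^2$. Let $W$ be the real linear space of all functions $D\colon(\mathbb{Z}/m\mathbb{Z})^2\to M_2(\mathbb{C})$ for which there exist functions $f,g\colon(\mathbb{Z}/m\mathbb{Z})^2\to\mathbb{C}$ such that for all $i,j\in\mathbb{Z}/m\mathbb{Z}$ $$D_{i,j}=\begin{pmatrix} f(i+1,j)-f(i,j) & f(i,j+1)-f(i,j)\\ g(i+1,j)-g(i,j) & g(i,j+1)-g(i,j)\end{pmatrix}.$$ Let $\nu\in\mathfrak{W}$, i.e. let $\nu$ be a finite $M_2(\mathbb{C})$-valued measure on $\mathbb{T}$ with $\mathrm{Diff}(\nu)\subset W$. Then $\frac{d\nu}{d|\nu|}(x)$ is a matrix of rank one for $|\nu_s|$-almost every $x\in\mathbb{T}$.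
   Context: Tree and path space. Let $q=m^2\ge 3$. Let $\mathcal{T}$ be the infinite $q$-regular rooted directed tree: it is connected, has no cycles, each vertex has exactly $q$ outgoing edges, each vertex except the root has exactly one incoming edge, and the root has none. If $v\to w$ then $w$ is called a son of $v$; for each vertex an enumeration of its sons by $1,\dots,q$, equivalently (via a fixed identification) by the elements of $(\mathbb{Z}/m\mathbb{Z})^2$, is fixed. $\mathbb{T}$ is the set of all infinite directed paths $x=(x(0),x(1),x(2),\dots)$ in $\mathcal{T}$ with $x(0)$ the root and each $x(n+1)$ a son of $x(n)$. For a vertex $v$ at graph distance $n$ from the root put $\omega_v=\{x\in\mathbb{T}: x(n)=v\}$; these $q^n$ sets are the atoms of generation $n$, and $\mathcal{AF}_n$ denotes the set of them, a partition of $\mathbb{T}$. $\mathcal{F}_n$ is the (finite) set algebra generated by $\mathcal{AF}_n$. The sons of the atom $\omega_v$ are the atoms $\omega_w$ with $w$ a son of $v$, with the same enumeration. $\mathbb{T}$ carries the $\sigma$-algebra $\sigma(\bigcup_n\mathcal{F}_n)$ and the uniform probability measure $\mu$, $\mu(\omega)=q^{-n}$ for $\omega\in\mathcal{AF}_n$. Measures and differences. For a finite (countably additive) $M_2(\mathbb{C})\cong\mathbb{R}^8$-valued measure $\nu$ on $\mathbb{T}$, put $\nu_n(\omega)=q^n\nu(\omega)$ for $\omega\in\mathcal{AF}_n$. For $\omega\in\mathcal{AF}_n$ with sons $\omega_{(i,j)}\in\mathcal{AF}_{n+1}$, $(i,j)\in(\mathbb{Z}/m\mathbb{Z})^2$,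 let $D_\omega$ be the function $(\mathbb{Z}/m\mathbb{Z})^2\to M_2(\mathbb{C})$ (equivalently a real $8\times q$ matrix with columns indexed by $(i,j)$) given by $(D_\omega)_{i,j}=\nu_{n+1}(\omega_{(i,j)})-\nu_n(\omega)$. $\mathrm{Diff}(\nu)$ is the set of all $D_\omega$, over all atoms $\omega$ of all generations $n\ge 0$. $\mathfrak{W}$ is the set of all finite $M_2(\mathbb{C})$-valued measures $\nu$ on $\mathbb{T}$ with $\mathrm{Diff}(\nu)\subset W$. Other notation. $\nu_s$ is the singular part of $\nu$ with respect to $\mu$ in the Lebesgue decomposition; $|\cdot|$ denotes the total variation measure (with respect to the Euclidean norm on $\mathbb{R}^8\cong M_2(\mathbb{C})$); $\frac{d\nu}{d|\nu|}$ is the Radon–Nikodym derivative of $\nu$ with respect to $|\nu|$. Rank means rank over $\mathbb{C}$. *)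

(* Defs.v *)
From HB Require Import structures.
From mathcomp Require Import all_boot all_order all_algebra.
From mathcomp Require Import all_classical all_reals all_analysis.
From mathcomp Require Import complex ring lra.

Set Implicit Arguments.
Unset Strict Implicit.
Unset Printing Implicit Defensive.

Import Order.TTheory GRing.Theory Num.Theory.
Import numFieldNormedType.Exports.

Local Open Scope classical_set_scope.
Local Open Scope ring_scope.

(* The Euclidean norm of M_2(C), identified with R^8. *)
Definition euclid_norm (R : realType) (A : 'M[R[i]]_2) : R :=
  Num.sqrt (\sum_i \sum_j (complex.Re (A i j) ^+ 2 + complex.Im (A i j) ^+ 2)).

(* As for the charges of the library, the values on nonmeasurable sets are
   irrelevant. *)
Record mxmeasure d (T : measurableType d) (R : realType) := MxMeasure {
  mxmeasure_fun :> set T -> 'M[R[i]]_2 ;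
  mxmeasure0 : mxmeasure_fun set0 = 0 ;
  mxmeasure_sigma_additive : forall F : nat -> set T,
    (forall k, measurable (F k)) -> trivIset setT F ->
    (fun n => euclid_norm (mxmeasure_fun (\bigcup_k F k) -
                           \sum_(k < n) mxmeasure_fun (F k))) @ \oo --> (0 : R)
}.

(* The supremum runs over sequences of disjoint measurable subsets of A instead
   of partitions of A, so that it is nonnegative also when A is not measurable;
   see mxvariationE for measurable A. *)
Definition mxvariation d (T : measurableType d) (R : realType)
    (nu : mxmeasure T R) (A : set T) : \bar R :=
  ereal_sup [set (\sum_(0 <= k <oo) (euclid_norm (nu (E k)))%:E)%E |
    E in [set E : nat -> set T | [/\ forall k, measurable (E k),
                                     trivIset setT E &
                                     \bigcup_k E k `<=` A]]].

Section euclid_norm_theory.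
Variable R : realType.
Implicit Types A B : 'M[R[i]]_2.

Lemma euclid_norm_ge0 A : 0 <= euclid_norm A.
Proof. exact: sqrtr_ge0. Qed.

Lemma euclid_norm0 : euclid_norm (0 : 'M[R[i]]_2) = 0.
Proof.
rewrite /euclid_norm !big1 ?sqrtr0// => i _; rewrite big1// => j _.
by rewrite mxE /= !expr0n /= addr0.
Qed.

Let minkowski2 (I : finType) (f g : I -> R) :
  Num.sqrt (\sum_i (f i + g i) ^+ 2) <=
  Num.sqrt (\sum_i f i ^+ 2) + Num.sqrt (\sum_i g i ^+ 2).
Proof.
pose a := \sum_i f i ^+ 2; pose b := \sum_i g i ^+ 2.
pose c := \sum_i f i * g i.
have a0 : 0 <= a by apply: sumr_ge0 => i _; exact: sqr_ge0.
have b0 : 0 <= b by apply: sumr_ge0 => i _; exact: sqr_ge0.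
have sE : \sum_i (f i + g i) ^+ 2 = a + b + c *+ 2.
  rewrite /a /b /c -sumrMnl -!big_split /=; apply: eq_bigr => i _.
  by rewrite sqrrD addrAC.
have sqE (u v : R) : \sum_i (u * f i - v * g i) ^+ 2 =
    u ^+ 2 * (\sum_i f i ^+ 2) - (u * v) *+ 2 * (\sum_i f i * g i) +
    v ^+ 2 * (\sum_i g i ^+ 2).
  rewrite !mulr_sumr -sumrB -big_split /=.
  by apply: eq_bigr => i _; ring.
have cs : c ^+ 2 <= a * b.
  have [b_eq0|bN0] := eqVneq b 0.
    suff -> : c = 0 by rewrite expr0n mulr_ge0.
    apply: big1 => i _.
    move/eqP: b_eq0; rewrite /b psumr_eq0; last by move=> j _; exact: sqr_ge0.
    by move/allP => /(_ i (mem_index_enum i)) /=; rewrite sqrf_eq0 => /eqP->;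
       rewrite mulr0.
  have bp : 0 < b by rewrite lt_neqAle eq_sym bN0.
  have : 0 <= \sum_i (b * f i - c * g i) ^+ 2.
    by apply: sumr_ge0 => i _; exact: sqr_ge0.
  suff -> : \sum_i (b * f i - c * g i) ^+ 2 = b * (a * b - c ^+ 2).
    by rewrite pmulr_rge0// subr_ge0.
  by rewrite sqE -/a -/b -/c; ring.
rewrite sE -(@ler_pXn2r _ 2)// ?nnegrE ?addr_ge0 ?sqrtr_ge0//.
rewrite sqrrD !sqr_sqrtr//; last first.
  by rewrite -sE; apply: sumr_ge0 => i _; exact: sqr_ge0.
rewrite -/a -/b addrAC lerD2r lerD2l -sqrtrM// lerMn2r /=.
by rewrite (le_trans (ler_norm c))// -sqrtr_sqr ler_wsqrtr.
Qed.

Let coord A (k : 'I_2 * ('I_2 * bool)) : R :=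
  if k.2.2 then complex.Re (A k.1 k.2.1) else complex.Im (A k.1 k.2.1).

Let euclid_normE A : euclid_norm A = Num.sqrt (\sum_k coord A k ^+ 2).
Proof.
congr Num.sqrt.
rewrite -(pair_bigA _ (fun i p => coord A (i, p) ^+ 2)) /=.
apply: eq_bigr => i _.
rewrite -(pair_bigA _ (fun j b => coord A (i, (j, b)) ^+ 2)) /=.
by apply: eq_bigr => j _; rewrite big_bool.
Qed.

Lemma euclid_normD A B : euclid_norm (A + B) <= euclid_norm A + euclid_norm B.
Proof.
rewrite !euclid_normE; apply: le_trans (minkowski2 _ _).
apply/ler_wsqrtr; apply: ler_sum => k _; rewrite /coord.
by case: ifP => _; rewrite mxE raddfD.
Qed.

Lemma euclid_norm_sum n (F : 'I_n -> 'M[R[i]]_2) :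
  euclid_norm (\sum_(k < n) F k) <= \sum_(k < n) euclid_norm (F k).
Proof.
elim/big_ind2 : _ => [|x a y b xa yb|//]; first by rewrite euclid_norm0.
exact: le_trans (euclid_normD _ _) (lerD xa yb).
Qed.

End euclid_norm_theory.

Section mxvariation_theory.
Context d (T : measurableType d) (R : realType) (nu : mxmeasure T R).
Local Open Scope ereal_scope.

Local Notation tv := (mxvariation nu).
Local Notation N A := (euclid_norm (nu A))%:E.

Let N_ge0 A : 0 <= N A. Proof. by rewrite lee_fin euclid_norm_ge0. Qed.

Let N_series_ge0 (E : nat -> set T) : 0 <= \sum_(0 <= k <oo) N (E k).
Proof. by apply: nneseries_ge0 => *; exact: N_ge0. Qed.

Let N_bigcup (F : nat -> set T) : (forall k, measurable (F k)) ->
  trivIset setT F -> N (\bigcup_k F k) <= \sum_(0 <= k <oo) N (F k).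
Proof.
move=> mF tF; apply/lee_addgt0Pr => e e0.
have /cvgrPdist_lt /(_ _ e0)[n _ /(_ n (leqnn n)) /=] :=
  mxmeasure_sigma_additive nu mF tF.
rewrite sub0r normrN ger0_norm ?euclid_norm_ge0// => ne.
apply: (@le_trans _ _ (\sum_(0 <= k < n) N (F k) + e%:E)); last first.
  by rewrite leeD2r//; apply: nneseries_lim_ge => *; exact: N_ge0.
rewrite sumEFin -EFinD lee_fin big_mkord.
rewrite -[X in euclid_norm X](subrK (\sum_(k < n) nu (F k))%R).
rewrite (le_trans (euclid_normD _ _))// addrC lerD ?euclid_norm_sum//.
exact: ltW.
Qed.

Lemma mxvariation_ge0 A : 0 <= tv A.
Proof.
apply: le_ereal_sup_tmp.
exists (\sum_(0 <= k <oo) N set0); last exact: N_series_ge0.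
exists (fun=> set0) => //=; split => //; last by move=> x [].
by apply/trivIsetP => *; rewrite setI0.
Qed.

Lemma mxvariation0 : tv set0 = 0.
Proof.
apply/eqP; rewrite eq_le mxvariation_ge0 andbT.
apply: ge_ereal_sup => _ [E [_ _ E0] <-].
rewrite eseries0// => k _ _.
rewrite (_ : E k = set0) ?mxmeasure0 ?euclid_norm0//.
by apply/seteqP; split => // x Ekx; apply: E0; exists k.
Qed.

Lemma le_mxvariation A B : A `<=` B -> tv A <= tv B.
Proof.
move=> AB; apply: ereal_sup_le => _ [E [mE tE EA] <-].
by exists E => //; split => //; exact: subset_trans AB.
Qed.

Let mxvariation_sup A (E : nat -> set T) : (forall k, measurable (E k)) ->
  trivIset setT E -> \bigcup_k E k `<=` A ->
  \sum_(0 <= k <oo) N (E k) <= tv A.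
Proof. by move=> mE tE EA; apply: ereal_sup_ubound; exists E. Qed.

Lemma mxvariationE A : measurable A ->
  tv A = ereal_sup [set \sum_(0 <= k <oo) N (E k) |
    E in [set E : nat -> set T | [/\ forall k, measurable (E k),
                                     trivIset setT E &
                                     \bigcup_k E k = A]]].
Proof.
move=> mA; apply/eqP; rewrite eq_le; apply/andP; split; last first.
  apply: ereal_sup_le => _ [E [mE tE EA] <-].
  by exists E => //; split => //; rewrite EA.
apply: ge_ereal_sup => _ [E [mE tE EA] <-].
pose G k := if k is k'.+1 then E k' else A `\` \bigcup_k E k.
apply: le_ereal_sup_tmp; exists (\sum_(0 <= k <oo) N (G k)).
  exists G => //; split.
  - case=> [|k] /=; last exact: mE.
    by apply: measurableD => //; exact: bigcup_measurable.
  - apply/trivIsetP => -[|i] [|j] _ _ //= ij.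
    + by apply/seteqP; split => // x [[_ nE] Ex]; apply: nE; exists j.
    + by apply/seteqP; split => // x [Ex [_ nE]]; apply: nE; exists i.
    + by move/trivIsetP : tE; apply.
  - apply/seteqP; split => [x [[|k] _ /= Gx]|x Ax].
    + by case: Gx.
    + by apply: EA; exists k.
    + have [[k _ Ekx]|nEx] := pselect ((\bigcup_k E k) x).
        by exists k.+1.
      by exists 0%N.
rewrite [leRHS](@nneseries_split _ _ 0%N 1%N); last by case=> *; exact: N_ge0.
rewrite add0n -[leLHS]add0e; apply: leeD; first by rewrite big_nat1 N_ge0.
rewrite -(@nneseries_addn _ (fun k => N (G k)) 1%N); last first.
  by move=> *; exact: N_ge0.
by under [leRHS]eq_eseriesr do rewrite addn1.
Qed.

Let mxvariationU A B : A `&` B = set0 -> tv A + tv B <= tv (A `|` B).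
Proof.
move=> AB0; have [->|tvoo] := eqVneq (tv (A `|` B)) +oo; first by rewrite leey.
have fin x : 0 <= x -> x <= tv (A `|` B) -> x \is a fin_num.
  move=> x0 xtv; rewrite ge0_fin_numE// (le_lt_trans xtv)//.
  by rewrite ltey.
have main E G : (forall k, measurable (E k)) -> trivIset setT E ->
    \bigcup_k E k `<=` A -> (forall k, measurable (G k)) -> trivIset setT G ->
    \bigcup_k G k `<=` B ->
    \sum_(0 <= k <oo) N (E k) + \sum_(0 <= k <oo) N (G k) <= tv (A `|` B).
  move=> mE tE EA mG tG GB.
  pose H k := if odd k then G k./2 else E k./2.
  have sumH n : \sum_(0 <= k < n) N (E k) + \sum_(0 <= k < n) N (G k) =
                \sum_(0 <= k < n.*2) N (H k).
    elim: n => [|n IH]; first by rewrite double0 !big_geq// adde0.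
    rewrite doubleS !big_nat_recr//= -IH /H /= odd_double /= uphalf_double.
    by rewrite doubleK addeACA addeA.
  apply: (@le_trans _ _ (\sum_(0 <= k <oo) N (H k))); last first.
    apply: mxvariation_sup.
    - by move=> k; rewrite /H; case: ifP.
    - apply/trivIsetP => i j _ _ ij; rewrite /H.
      have disj k l : E k `&` G l = set0.
        rewrite -subset0 -AB0 => x [Ex Gx]; split.
          by apply: EA; exists k.
        by apply: GB; exists l.
      case: ifPn => oi; case: ifPn => oj; rewrite ?disj// 1?setIC ?disj//.
        move/trivIsetP : tG; apply => //; apply: contra ij => /eqP h.
        by rewrite -(odd_double_half i) -(odd_double_half j) h oi oj.
      rewrite setIC; move/trivIsetP : tE; apply => //; apply: contra ij => /eqP h.
      by rewrite -(odd_double_half i) -(odd_double_half j) h (negbTE oi) (negbTE oj).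
    - move=> x [k _]; rewrite /H; case: ifP => _ ?.
        by right; apply: GB; exists k./2.
      by left; apply: EA; exists k./2.
  rewrite -nneseriesD; [|by move=> *; exact: N_ge0..].
  apply: lime_le; first by apply: is_cvg_nneseries => *; exact: adde_ge0.
  apply: nearW => n; rewrite big_split /= sumH.
  by apply: nneseries_lim_ge => *; exact: N_ge0.
have fA : tv A \is a fin_num.
  by apply: fin; [exact: mxvariation_ge0|exact: le_mxvariation].
rewrite addeC -leeBrDr//; apply: ge_ereal_sup => _ [G [mG tG GB] <-].
have fG : \sum_(0 <= k <oo) N (G k) \is a fin_num.
  apply: fin; first exact: N_series_ge0.
  by apply: mxvariation_sup => //; exact: subset_trans (@subsetUr _ _ _).
rewrite leeBrDr// addeC -leeBrDr//.
apply: ge_ereal_sup => _ [E [mE tE EA] <-].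
by rewrite leeBrDr//; exact: main.
Qed.

Let mxvariation_sigma_additive : semi_sigma_additive tv.
Proof.
move=> F mF tF mU.
have tv0 n : 0 <= tv (F n) by exact: mxvariation_ge0.
suff -> : tv (\bigcup_n F n) = \sum_(0 <= i <oo) tv (F i).
  by apply: is_cvg_nneseries => *.
apply/eqP; rewrite eq_le; apply/andP; split.
  apply: ge_ereal_sup => _ [E [mE tE EU] <-].
  apply: (@le_trans _ _
      (\sum_(0 <= k <oo) \sum_(0 <= i <oo) N (E k `&` F i))).
    apply: lee_nneseries => [*|k _]; first exact: N_ge0.
    rewrite {1}(_ : E k = \bigcup_i (E k `&` F i)); last first.
      rewrite -setI_bigcupr; apply/esym/setIidl.
      by apply: subset_trans EU; exact: bigcup_sup.
    apply: N_bigcup => [i|]; first exact: measurableI.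
    by apply/trivIsetP => i j _ _ ij; rewrite setIACA (trivIsetP.1 tF)// setI0.
  rewrite nneseries_interchange; last by move=> *; exact: N_ge0.
  apply: lee_nneseries => [*|i _]; first exact: N_series_ge0.
  apply: mxvariation_sup => [k||x [k _ []]//]; first exact: measurableI.
  by apply/trivIsetP => k l _ _ kl; rewrite setIACA (trivIsetP.1 tE)// set0I.
apply: lime_le; first exact: is_cvg_nneseries.
apply: nearW => n.
apply: (@le_trans _ _ (tv (\big[setU/set0]_(0 <= i < n) F i))); last first.
  apply: le_mxvariation; rewrite big_mkord; exact: bigsetU_bigcup.
elim: n => [|n IH]; first by rewrite !big_geq// mxvariation_ge0.
rewrite !big_nat_recr//=; apply: le_trans (leeD2r _ IH) _.
apply: mxvariationU; rewrite big_mkord.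
by apply: (@trivIset_bigsetUI _ predT) => //; exact: sub_trivIset tF.
Qed.

HB.instance Definition _ := isMeasure.Build d T R tv mxvariation0
  mxvariation_ge0 mxvariation_sigma_additive.

End mxvariation_theory.

(* The Radon-Nikodym derivative as a relation: h is any of its versions, which
   agree lambda-almost everywhere. *)
Definition mxdensity d (T : measurableType d) (R : realType)
    (nu : mxmeasure T R) (lambda : {measure set T -> \bar R})
    (h : T -> 'M[R[i]]_2) : Prop :=
  (forall i j, lambda.-integrable setT (fun x => (complex.Re (h x i j))%:E) /\
               lambda.-integrable setT (fun x => (complex.Im (h x i j))%:E)) /\
  (forall A, measurable A -> forall i j,
     complex.Re (nu A i j) = \int[lambda]_(x in A) complex.Re (h x i j) /\
     complex.Im (nu A i j) = \int[lambda]_(x in A) complex.Im (h x i j)).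

(* Determines nu_s on measurable sets, by uniqueness of the Lebesgue
   decomposition nu = nu_a + nu_s. *)
Definition singular_part d (T : measurableType d) (R : realType)
    (mu : {measure set T -> \bar R}) (nu nu_s : mxmeasure T R) : Prop :=
  exists nu_a : mxmeasure T R,
    [/\ forall A, measurable A -> nu A = nu_a A + nu_s A,
        forall A, measurable A -> mu A = 0%E -> nu_a A = 0 &
        exists N, [/\ measurable N, mu N = 0%E &
                      mxvariation nu_s (~` N) = 0%E]].

(* Sons are enumerated by (Z/mZ)^2.  The type 'Z_m is Z/mZ only for m >= 2. *)
Definition sons (m : nat) : Type := ('Z_m * 'Z_m)%type.
HB.instance Definition _ m := Finite.on (sons m).
HB.instance Definition _ m := isPointed.Build (sons m) (0, 0).

(* A vertex at distance n from the root is the word of length n of the indices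
   of the successive sons leading to it; the sons of v are the rcons v ij. *)
Definition vertex (m : nat) : Type := seq (sons m).

(* A path is given by the indices of its successive vertices. *)
Definition tree_path (m : nat) : Type := nat -> sons m.
HB.instance Definition _ m := Pointed.copy (tree_path m) (nat -> sons m).

(* The n-th vertex x(n) of the path x. *)
Definition path_vertex m (x : tree_path m) (n : nat) : vertex m := mkseq x n.

Definition atom m (v : vertex m) : set (tree_path m) :=
  [set x | path_vertex x (size v) = v].

Definition atoms m (n : nat) : set (set (tree_path m)) :=
  [set atom v | v in [set v : vertex m | size v = n]].

Definition set_algebra T (G : set (set T)) : Prop :=
  [/\ G set0, setC_closed G & setU_closed G].

Definition atom_algebra m (n : nat) : set (set (tree_path m)) :=
  smallest (@set_algebra (tree_path m)) (@atoms m n).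

Definition pathspace (m : nat) : Type :=
  g_sigma_algebraType (\bigcup_n @atom_algebra m n).
HB.instance Definition _ m := Measurable.on (pathspace m).

Definition uniform_measure m (R : realType)
    (mu : {measure set (pathspace m) -> \bar R}) : Prop :=
  forall v : vertex m, mu (atom v) = (((m ^ 2)%:R ^- size v)%:E).

Section differences.
Variables (m : nat) (R : realType).
Implicit Types (nu : mxmeasure (pathspace m) R) (v : vertex m).

(* nu_n(omega) for the atom omega = atom v of generation n = size v. *)
Definition atom_value nu v : 'M[R[i]]_2 :=
  ((m ^ 2)%:R ^+ size v) *: nu (atom v).

Definition difference nu v : sons m -> 'M[R[i]]_2 :=
  fun ij => atom_value nu (rcons v ij) - atom_value nu v.

Definition Diff nu : set (sons m -> 'M[R[i]]_2) := range (difference nu).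

Definition mx22 (a b c d : R[i]) : 'M[R[i]]_2 :=
  \matrix_(r, s) (if r == 0 then if s == 0 then a else b
                  else if s == 0 then c else d).

Definition discrete_gradients : set (sons m -> 'M[R[i]]_2) :=
  [set D | exists f g : 'Z_m -> 'Z_m -> R[i], forall i j : 'Z_m,
     D (i, j) = mx22 (f (i + 1) j - f i j) (f i (j + 1) - f i j)
                     (g (i + 1) j - g i j) (g i (j + 1) - g i j)].

End differences.

(* Main.v *)
Require Import Defs.
From HB Require Import structures.
From mathcomp Require Import all_boot all_order all_algebra.
From mathcomp Require Import all_classical all_reals all_analysis.
From mathcomp Require Import measurable_realfun complex ring lra.

Set Implicit Arguments.
Unset Strict Implicit.
Unset Printing Implicit Defensive.

Import Order.TTheory GRing.Theory Num.Theory.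

Local Open Scope classical_set_scope.
Local Open Scope ring_scope.

(* Suppose that h has rank 2 on a mu-null set of positive |nu|-measure.  After
   left multiplication by a suitable matrix b, under which the space of discrete
   gradients is stable, h is close to the identity on a mu-null set A of
   positive |nu|-measure, hence b nu is close to |nu| I on some atom almost all
   of whose |nu|-mass lies in A.  If D is both a gradient up to an error e and a
   scalar multiple d I of the identity, then all partial differences of d are
   partial differences of e, so that the increments of |nu| are controlled by
   those of the deviation b nu - |nu| I, whose total variation on the atom is
   small.  As in the weak type (1,1) estimate for martingale transforms, the
   density martingale of |nu| can then drop below half of its initial value only
   on a small part of the atom; but it does so on most of the atom, because
   |nu| is concentrated there on a mu-null set. *)

(** * Martingales on the tree *)

Definition tree_martingale (R : nzRingType) (I : finType) (x : seq I -> R) :=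
  forall v, \sum_i x (rcons v i) = #|I|%:R * x v.

(** Orthogonality of martingale increments: the cross term collapses because the sons average to
    [x v]. *)
Lemma sum_sqr_increments (R : comNzRingType) (I : finType) (x : seq I -> R) v :
  tree_martingale x ->
  \sum_i (x (rcons v i) - x v) ^+ 2 =
  \sum_i x (rcons v i) ^+ 2 - #|I|%:R * x v ^+ 2.
Proof.
move=> xm.
have -> : #|I|%:R * x v ^+ 2 =
    x v * (\sum_i x (rcons v i)) *+ 2 - \sum_(i : I) x v ^+ 2.
  by rewrite xm sumr_const -mulr_natl; ring.
rewrite mulr_sumr -sumrMnl -!sumrB; apply: eq_bigr => i _; ring.
Qed.

Section supersolution.
Variables (R : realFieldType) (I K : finType) (C : R).
Variables (x r y : seq I -> R) (s : K -> seq I -> R) (N : nat).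
Hypotheses (C0 : 0 <= C) (I0 : (0 < #|I|)%N).
Hypotheses (xm : tree_martingale x) (rm : tree_martingale r)
  (ym : tree_martingale y) (sm : forall k, tree_martingale (s k)).
Hypotheses (y0 : forall v, 0 <= y v) (sr : forall k v, `|s k v| <= r v).
Hypothesis xs : forall v,
  \sum_i (x (rcons v i) - x v) ^+ 2 <=
  C * \sum_k \sum_i (s k (rcons v i) - s k v) ^+ 2.
Hypothesis r0 : forall v, 0 <= r v.
Hypothesis xy : forall v, size v = N -> 1 / 2 < x v -> 1 <= y v.

Let q : R := #|I|%:R.
(** While [r w <= q], the squares of the [s k w] sum to at most [#|K| * q * r w]; hence [M * r] pays
    for the subtracted squares and leaves one [r] over. *)
Let M := 1 + 4 * C * #|K|%:R * q.

(* The right-hand side is a Bellman function: its average over the sons of v is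
   at most its value at v, and the induction stops as soon as r exceeds 1. It
   replaces stopping the martingales when r becomes large and bounding the
   stopped ones in L^2; r <= q is what remains true one step later. *)
Lemma supersolution_ge1 v : (size v <= N)%N -> r v <= q ->
  1 <= 4 * ((x v - 1) ^+ 2 - C * \sum_k s k v ^+ 2) + M * r v + y v.
Proof.
have q0 : 0 < q by rewrite ltr0n.
have sq w : r w <= q -> r w <= M * r w - 4 * (C * \sum_k s k w ^+ 2).
  move=> rq.
  have : \sum_k s k w ^+ 2 <= #|K|%:R * (q * r w).
    have -> : #|K|%:R * (q * r w) = \sum_(k : K) (q * r w).
      by rewrite sumr_const mulr_natl.
    apply: ler_sum => k _; rewrite -real_normK ?num_real// expr2.
    by apply: ler_pM => //; apply: le_trans (sr k w) _.
  move/(ler_wpM2l C0); rewrite /M; lra.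
elim: {v}(N - size v)%N {-2}v (erefl (N - size v)%N) => [|n IH] v nE vN rq.
  have vE : size v = N by apply/eqP; rewrite eqn_leq vN -subn_eq0 nE.
  have := sq _ rq; have := r0 v; have [xv _ _|/(xy vE)] := leP (x v) (1 / 2).
    (* The product equals [(x v - 1) ^+ 2 - 1 / 4], so [4 * (x v - 1) ^+ 2] is at least 1. *)
    have := y0 v; have : 0 <= (1 / 2 - x v) * (3 / 2 - x v).
      by apply: mulr_ge0; lra.
    have := sq _ rq; have := r0 v; nra.
  by have := sqr_ge0 (x v - 1); lra.
have [r1|r1] := leP (r v) 1; last first.
  have := sq _ rq; have := sqr_ge0 (x v - 1); have := y0 v; lra.
have sons_ge i : 1 <= 4 * ((x (rcons v i) - 1) ^+ 2 -
    C * \sum_k s k (rcons v i) ^+ 2) + M * r (rcons v i) + y (rcons v i).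
  have vlt : (size v < N)%N by rewrite -subn_gt0 nE.
  apply: IH; rewrite ?size_rcons//; first by rewrite subnS nE.
  (* One son carries at most the whole sum [q * r v] of nonnegative values, and [r v <= 1] here. *)
  rewrite (@le_trans _ _ (q * r v))//; last by rewrite ger_pMr.
  by rewrite -rm (bigD1 i)//= lerDl sumr_ge0.
have x1m : tree_martingale (fun w => x w - 1).
  by move=> w; rewrite sumrB xm sumr_const /=; ring.
have : q <= \sum_i (4 * ((x (rcons v i) - 1) ^+ 2 -
    C * \sum_k s k (rcons v i) ^+ 2) + M * r (rcons v i) + y (rcons v i)).
  have -> : q = \sum_(i : I) 1 by rewrite sumr_const.
  by apply: ler_sum => i _; exact: sons_ge.
rewrite !big_split /= -!mulr_sumr rm ym -/q sumrB -mulr_sumr exchange_big /=.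
(* By [xs], the squares of [x - 1] grow on average by at most [C] times the growth of the squares of
   the [s k], while [r] and [y] keep their averages. *)
have dxE : \sum_i (x (rcons v i) - x v) ^+ 2 =
    \sum_i (x (rcons v i) - 1) ^+ 2 - q * (x v - 1) ^+ 2.
  rewrite -(sum_sqr_increments v x1m); apply: eq_bigr => i _.
  by congr (_ ^+ 2); ring.
have := xs v; rewrite dxE.
under [X in C * X]eq_bigr do rewrite sum_sqr_increments//.
rewrite sumrB -mulr_sumr -/q => dx le_q.
rewrite -(ler_pM2l q0) mulr1; nra.
Qed.

End supersolution.

(** * Oscillation and gradients on the discrete torus *)

Lemma norm_sub_Zp_le (R : realDomainType) (m : nat) (u : 'Z_m -> R) (L : R) :
  (1 < m)%N -> (forall i, `|u (i + 1) - u i| <= L) ->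
  forall i j, `|u i - u j| <= m%:R * L.
Proof.
move=> m1 uL i j; have L0 : 0 <= L by apply: le_trans (uL 0).
have steps k : `|u (j + k%:R) - u j| <= k%:R * L.
  elim: k => [|k IH]; first by rewrite addr0 subrr normr0 mul0r.
  rewrite -!natr1 addrA mulrDl mul1r [leRHS]addrC.
  by rewrite (le_trans (ler_distD (u (j + k%:R)) _ _))// lerD.
(* [i - j] has a representative below [m], so fewer than [m] unit steps lead from [j] to [i]. *)
have -> : i = j + (nat_of_ord (i - j))%:R by rewrite natr_Zp addrC subrK.
rewrite (le_trans (steps _))//.
by rewrite ler_wpM2r// ler_nat ltnW// -[ltnRHS](Zp_cast m1).
Qed.

(** A discrete Poincaré inequality. Walking along one axis and then the other, two values differ by
    at most [2 * (m * L)]; having zero sum, [e] obeys this bound pointwise, and there are [m ^ 2]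
    points. *)
Lemma sum_sqr_le_gradient (R : realFieldType) (m : nat)
    (e : 'Z_m * 'Z_m -> R) (L : R) :
  (1 < m)%N -> \sum_p e p = 0 ->
  (forall i j, `|e (i + 1, j) - e (i, j)| <= L) ->
  (forall i j, `|e (i, j + 1) - e (i, j)| <= L) ->
  \sum_p e p ^+ 2 <= 4 * m%:R ^+ 4 * L ^+ 2.
Proof.
move=> m1 e0 e1 e2.
have cardZ : #|{: 'Z_m * 'Z_m}| = (m * m)%N.
  by rewrite card_prod !card_ord Zp_cast.
have m0 : 0 < m%:R :> R by rewrite ltr0n; exact: ltnW.
have osc p p' : `|e p - e p'| <= 2 * (m%:R * L).
  rewrite (le_trans (ler_distD (e (p'.1, p.2)) _ _))//.
  rewrite mulr2n mulrDl mul1r lerD//.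
    case: p => i j /=.
    by apply: (norm_sub_Zp_le (u := fun i => e (i, j))) => // k; exact: e1.
  case: p' => i j /=.
  by apply: (norm_sub_Zp_le (u := fun j => e (i, j))) => // k; exact: e2.
have eL p : `|e p| <= 2 * (m%:R * L).
  rewrite -(ler_pM2l (mulr_gt0 m0 m0)) -natrM -cardZ -normr_nat -normrM.
  rewrite (_ : _ * e p = \sum_p' (e p - e p')); last first.
    by rewrite sumrB e0 subr0 sumr_const mulr_natl.
  rewrite (le_trans (ler_norm_sum _ _ _))// normr_nat.
  rewrite -(sumr_const {: 'Z_m * 'Z_m}) mulr_suml.
  by apply: ler_sum => p' _; rewrite mul1r.
have -> : 4 * m%:R ^+ 4 * L ^+ 2 =
    \sum_(p : 'Z_m * 'Z_m) (2 * (m%:R * L)) ^+ 2.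
  by rewrite sumr_const cardZ -[RHS]mulr_natl natrM; ring.
apply: ler_sum => p _; rewrite -real_normK ?num_real// !expr2.
by apply: ler_pM.
Qed.

(* Here d I + e is a discrete gradient: e.g. the first row (d + e00, e01) is the
   gradient of F 0, so the second difference of d is the first difference of e01
   minus the second difference of e00. *)
Lemma gradient_error_bound (R : rcfType) (m : nat) (d : 'Z_m * 'Z_m -> R)
    (e : 'I_2 * 'I_2 -> 'Z_m * 'Z_m -> R) (F : 'I_2 -> 'Z_m -> 'Z_m -> R) :
  (1 < m)%N -> \sum_p d p = 0 ->
  (forall r i j, (r == 0)%:R * d (i, j) + e (r, 0) (i, j) =
     F r (i + 1) j - F r i j) ->
  (forall r i j, (r == 1)%:R * d (i, j) + e (r, 1) (i, j) =
     F r i (j + 1) - F r i j) ->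
  \sum_p d p ^+ 2 <= 64 * m%:R ^+ 4 * \sum_k \sum_p e k p ^+ 2.
Proof.
move=> m1 d0 F1 F2; set S := \sum_k _.
have S0 : 0 <= S by do 2!apply: sumr_ge0 => ? _; exact: sqr_ge0.
have eS k p : `|e k p| <= Num.sqrt S.
  rewrite -sqrtr_sqr ler_wsqrtr// /S (bigD1 k)//= (bigD1 p)//= -addrA lerDl.
  by rewrite addr_ge0//; do ?[apply: sumr_ge0 => ? _]; exact: sqr_ge0.
have four k1 p1 k2 p2 k3 p3 k4 p4 :
    `|e k1 p1 - e k2 p2 - (e k3 p3 - e k4 p4)| <= 4 * Num.sqrt S.
  rewrite (le_trans (ler_normB _ _))//.
  have := ler_normB (e k1 p1) (e k2 p2); have := ler_normB (e k3 p3) (e k4 p4).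
  have := eS k1 p1; have := eS k2 p2; have := eS k3 p3; have := eS k4 p4; lra.
(* Each first difference of [d] combines four values of [e], each at most [sqrt S] in absolute
   value; thus 64 arises as [4 * 4 ^ 2]. *)
have -> : 64 * m%:R ^+ 4 * S = 4 * m%:R ^+ 4 * (4 * Num.sqrt S) ^+ 2.
  by rewrite exprMn sqr_sqrtr//; ring.
apply: sum_sqr_le_gradient => // i j.
(* Row 1 controls the differences of [d] in the first direction, row 0 those in the second; each
   time the mixed differences of [F] cancel. *)
- have := F1 1 i j; have := F1 1 i (j + 1).
  have := F2 1 i j; have := F2 1 (i + 1) j.
  rewrite /= !mul0r !mul1r !add0r => h1 h2 h3 h4.
  rewrite (_ : _ - _ = e (1, 0) (i, j + 1) - e (1, 0) (i, j)
     - (e (1, 1) (i + 1, j) - e (1, 1) (i, j))); first exact: four.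
  lra.
- have := F2 0 i j; have := F2 0 (i + 1) j.
  have := F1 0 i j; have := F1 0 i (j + 1).
  rewrite /= !mul0r !mul1r !add0r => h1 h2 h3 h4.
  rewrite (_ : _ - _ = e (0, 1) (i + 1, j) - e (0, 1) (i, j)
     - (e (0, 0) (i, j + 1) - e (0, 0) (i, j))); first exact: four.
  lra.
Qed.

(** * Open sets of paths and outer regularity *)

Section tree_topology.
Variable m : nat.
Implicit Types (x y : pathspace m) (v w : vertex m) (A B G : set (pathspace m)).

Lemma measurable_atom v : measurable (atom v : set (pathspace m)).
Proof.
apply: sub_gen_smallest; exists (size v) => //.
by apply: sub_gen_smallest; exists v.
Qed.

(** The union of the atoms of generation [n] inside [G]. It increases with [n] and exhausts [G]
    exactly when [G] is open in the topology with the atoms as a base. *)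
Definition layer G n : set (pathspace m) :=
  [set x | atom (path_vertex x n) `<=` G].

Definition tree_open G := G = \bigcup_n layer G n.

Lemma atom_path_vertex x n : atom (path_vertex x n) x.
Proof. by rewrite /atom/= /path_vertex size_mkseq. Qed.

Lemma layer_sub G n : layer G n `<=` G.
Proof. by move=> x; apply; exact: atom_path_vertex. Qed.

Lemma atom_rcons v ij : atom (rcons v ij) `<=` atom v.
Proof.
move=> x; rewrite /atom /= /path_vertex size_rcons mkseqS.
by move=> /rcons_inj[].
Qed.

Lemma atom_sons v :
  (atom v : set (pathspace m)) =
  \bigcup_(ij in [set: sons m]) atom (rcons v ij).
Proof.
apply/seteqP; split => [x|x [ij _]]; last exact: atom_rcons.
rewrite /atom /= => xv; exists (x (size v)) => //=.
by rewrite /path_vertex size_rcons mkseqS /= -/(path_vertex x _) xv.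
Qed.

Lemma trivIset_sons v : trivIset setT (fun ij => atom (rcons v ij)).
Proof.
move=> i j _ _ [x []]; rewrite /atom /= => xi; rewrite !size_rcons in xi *.
by rewrite xi => /rcons_inj[].
Qed.

Lemma atom_eq v w x : size v = size w -> atom v x -> atom w x -> v = w.
Proof.
by rewrite /atom /= => vw xv xw; rewrite -[RHS]xw -vw.
Qed.

Lemma sub_path_vertex x n k : (n <= k)%N ->
  atom (path_vertex x k) `<=` atom (path_vertex x n).
Proof.
move=> nk y; rewrite /atom /= /path_vertex !size_mkseq => yx.
have := congr1 (take n) yx; rewrite /mkseq -!map_take take_iota.
by rewrite (minn_idPl nk).
Qed.

Lemma layer_homo G : {homo layer G : n k / (n <= k)%N >-> n `<=` k}.
Proof. by move=> n k nk x; apply: subset_trans; exact: sub_path_vertex. Qed.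

Lemma atom_layer G v :
  atom v `<=` layer G (size v) \/ atom v `&` layer G (size v) = set0.
Proof.
have [vG|vG] := pselect (atom v `<=` G); [left|right] => [x xv|].
  by rewrite /layer /= xv.
apply/seteqP; split => // x [/= xv]; rewrite /layer /= xv; exact: vG.
Qed.

Lemma measurable_layer G n : measurable (layer G n).
Proof.
rewrite (_ : layer G n = \bigcup_(v in [set: seq (sons m)])
    (if `[< size v = n /\ atom v `<=` G >] then atom v else set0)).
  apply: countable_bigcupT_measurable; first exact: countableP.
  by move=> v; case: ifP => // _; exact: measurable_atom.
apply/seteqP; split => [x Gx|x [v _]]; last first.
  by case: ifPn => // /asboolP[<- vG] xv; rewrite /layer /= xv.
exists (path_vertex x n) => //; rewrite asboolT; first exact: atom_path_vertex.
by split => //; rewrite size_mkseq.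
Qed.

Lemma tree_openP G :
  (forall x, G x -> exists n, atom (path_vertex x n) `<=` G) -> tree_open G.
Proof.
move=> GP; apply/seteqP; split => [x /GP[n Gn]|x [n _]]; first by exists n.
exact: layer_sub.
Qed.

Lemma tree_open_nbhs G x : tree_open G -> G x ->
  exists n, atom (path_vertex x n) `<=` G.
Proof. by rewrite {1}/tree_open => {1}-> [n _ Gn]; exists n. Qed.

Lemma measurable_tree_open G : tree_open G -> measurable G.
Proof.
by move=> ->; apply: bigcup_measurable => ? _; exact: measurable_layer.
Qed.

Lemma tree_open_bigcup I (D : set I) (F : I -> set (pathspace m)) :
  (forall i, D i -> tree_open (F i)) -> tree_open (\bigcup_(i in D) F i).
Proof.
move=> oF; apply: tree_openP => x [i Di /(tree_open_nbhs (oF _ Di))[n Fn]].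
by exists n; apply: subset_trans Fn _ => y Fy; exists i.
Qed.

Lemma tree_openI G H : tree_open G -> tree_open H -> tree_open (G `&` H).
Proof.
move=> oG oH; apply: tree_openP => x [].
move=> /(tree_open_nbhs oG)[n Gn] /(tree_open_nbhs oH)[k Hk].
exists (maxn n k) => y yx; split; [apply: Gn|apply: Hk];
  apply: sub_path_vertex yx; [exact: leq_maxl|exact: leq_maxr].
Qed.

Lemma tree_openT : tree_open setT.
Proof. by apply: tree_openP => x _; exists 0%N. Qed.

Lemma tree_open_atom v : tree_open (atom v).
Proof. by apply: tree_openP => x xv; exists (size v); rewrite xv. Qed.

Lemma tree_open_atomC v : tree_open (~` atom v).
Proof.
apply: tree_openP => x xv; exists (size v) => y; rewrite /atom/= size_mkseq.
by move=> yx; rewrite /atom /= yx.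
Qed.

End tree_topology.

Lemma nonincreasing_measure_le d (T : measurableType d) (R : realType)
    (mu : {measure set T -> \bar R}) (F : nat -> set T) (e e' : R) :
  (mu setT < +oo)%E -> (forall n, measurable (F n)) -> nonincreasing_seq F ->
  e < e' -> (mu (\bigcap_n F n) <= e%:E)%E -> exists n, (mu (F n) <= e'%:E)%E.
Proof.
move=> muoo mF nF ee' Fe.
have cvg : mu (F n) @[n --> \oo] --> mu (\bigcap_n (F n)).
  apply: nonincreasing_cvg_mu => //; last exact: bigcapT_measurable.
  by apply: le_lt_trans muoo; apply: le_measure; rewrite ?inE.
apply: contrapT => /forallNP Fn.
have : (e'%:E <= mu (\bigcap_n F n))%E.
  rewrite -(cvg_lim _ cvg)//; apply: lime_ge; first exact: cvgP cvg.
  by apply: nearW => n; rewrite ltW// ltNge; exact/negP.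
by move=> /le_trans /(_ Fe); rewrite lee_fin leNgt ee'.
Qed.

Section regularity.
Context (m : nat) (R : realType) (mu : {measure set (pathspace m) -> \bar R}).
Hypothesis mufin : (mu setT < +oo)%E.
Local Open Scope ereal_scope.
Implicit Types (A G H : set (pathspace m)).

(** Treating [A] and its complement symmetrically gives closure under complements at once, on the
    way to a sigma-algebra. *)
Let approximable A := forall e : R, (0 < e)%R -> exists G H,
  [/\ tree_open G, tree_open H, A `<=` G, ~` A `<=` H & mu (G `&` H) <= e%:E].

Let approximableC A : approximable A -> approximable (~` A).
Proof.
move=> aA e e0; have [G [H [oG oH AG AH GH]]] := aA _ e0.
by exists H, G; split => //; rewrite ?setCK// setIC.
Qed.

(** An infinite intersection of the [H k] need not be open, so only finitely many are kept;
    continuity from above shows that enough of them suffice. *)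
Let approximable_bigcup (F : nat -> set (pathspace m)) :
  (forall k, approximable (F k)) -> approximable (\bigcup_k F k).
Proof.
move=> aF e e0.
(* The [d k] sum to [e / 2]; the other half is spent on truncating the intersection. *)
pose d k : R := (e / 2 / (2 ^ k.+1)%:R)%R.
have d0 k : (0 < d k)%R by rewrite !divr_gt0.
have [k|GH GHP] := @choice _ _
  (fun k (p : set (pathspace m) * set (pathspace m)) =>
    [/\ tree_open p.1, tree_open p.2, F k `<=` p.1,
       ~` F k `<=` p.2 & mu (p.1 `&` p.2) <= (d k)%:E]).
  by have [G [H ?]] := aF k _ (d0 k); exists (G, H).
pose G k := (GH k).1; pose H k := (GH k).2.
have oG k : tree_open (G k) by case: (GHP k).
have oH k : tree_open (H k) by case: (GHP k).
pose U := \bigcup_k G k.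
have oU : tree_open U by exact: tree_open_bigcup.
pose V n := \bigcap_(k in `I_n) H k.
have oV n : tree_open (V n).
  elim: n => [|n IH]; first by rewrite /V II0 bigcap_set0; exact: tree_openT.
  by rewrite /V IIS bigcap_setU bigcap_set1; exact: tree_openI.
have mUV n : measurable (U `&` V n).
  by apply: measurable_tree_open; apply: tree_openI.
have mcap : measurable (\bigcap_n (U `&` V n)) by exact: bigcapT_measurable.
have UVoo : mu (\bigcap_n (U `&` V n)) <= (e / 2)%:E.
  have GHU : \bigcap_n (U `&` V n) `<=` \bigcup_k (G k `&` H k).
    move=> x xUV; have [k _ Gk] := (xUV 0%N I).1.
    by exists k => //; split => //; apply: (xUV k.+1 I).2 => /=.
  have mGH k : measurable (G k `&` H k).
    by apply: measurable_tree_open; apply: tree_openI.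
  have mcup : measurable (\bigcup_k (G k `&` H k)) by exact: bigcupT_measurable.
  have le1 : mu (\bigcap_n (U `&` V n)) <= mu (\bigcup_k (G k `&` H k)).
    by apply: le_measure; rewrite ?inE.
  have le2 := measure_sigma_subadditive mu mGH mcup (@subset_refl _ _).
  apply: le_trans le1 (le_trans le2 _).
  have e20 : (0 <= e / 2)%R by rewrite ltW// divr_gt0.
  apply: le_trans (epsilon_trick0 xpredT e20).
  by apply: lee_nneseries => // k _ ; case: (GHP k).
have [||n UVn] := nonincreasing_measure_le mufin mUV _ _ UVoo (e' := e).
- move=> n k nk; apply/subsetPset; apply: setIS => x Vx i /= ik.
  exact/Vx/(leq_trans ik).
- lra.
exists U, (V n); split => //.
- by move=> x [k _ Fx]; exists k => //; case: (GHP k) => _ _ + _ _; apply.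
- move=> x nFx k _; case: (GHP k) => _ _ _ + _; apply => Fx.
  by apply: nFx; exists k.
Qed.

(** The approximable sets form a sigma-algebra containing the atoms, which are open with open
    complement. Generation is unfolded twice: from the algebras, then from the atoms. *)
Let approximable_measurable A : measurable A -> approximable A.
Proof.
have ap0 : approximable set0.
  move=> e e0; exists set0, setT; split => //.
  - by apply: tree_openP.
  - exact: tree_openT.
  - by rewrite set0I measure0 lee_fin ltW.
move: A; apply: smallest_sub.
  split => //.
  by move=> A; rewrite setTD; exact: approximableC.
move=> A [n _]; move: A; apply: smallest_sub.
  split => //.
  move=> A B aA aB; rewrite -bigcup2E; apply: approximable_bigcup.
  by case=> [|[|k]].
move=> _ [v _ <-] e e0; exists (atom v), (~` atom v); split => //.
- exact: tree_open_atom.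
- exact: tree_open_atomC.
- by rewrite setICr measure0 lee_fin ltW.
Qed.

Lemma tree_outer_regular A (e : R) : measurable A -> (0 < e)%R -> mu A = 0 ->
  exists G, [/\ tree_open G, A `<=` G & mu G <= e%:E].
Proof.
move=> mA e0 A0; have [G [H [oG oH AG AH GH]]] := approximable_measurable mA e0.
exists G; split => //.
have mG : measurable G by exact: measurable_tree_open.
have mGH : measurable (G `&` H).
  by apply: measurable_tree_open; apply: tree_openI.
(* Outside [A] the set [G] lies in [H], so [G] is covered by the null set [A] and the intersection
   of [G] and [H]. *)
apply: le_trans GH; rewrite -[leRHS]add0e -A0.
apply: le_trans (measureU2 _ mA mGH); apply: le_measure; rewrite ?inE//.
  exact: measurableU.
by move=> x Gx; have [|/AH] := pselect (A x); [left|right].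
Qed.

End regularity.

(** * Densities of additive set functions *)

Section additive_set_functions.
Context d (T : measurableType d) (R : realType).
Implicit Types (A B : set T) (F G : set T -> R).
Implicit Types mu : {measure set T -> \bar R}.

Definition finitely_additive F := forall A B, measurable A -> measurable B ->
  A `&` B = set0 -> F (A `|` B) = F A + F B.

Lemma finitely_additive_fine mu : (mu setT < +oo)%E ->
  finitely_additive (fun A => fine (mu A)).
Proof.
move=> muoo A B mA mB AB.
have fin D : measurable D -> mu D \is a fin_num.
  move=> mD; rewrite ge0_fin_numE//; apply: le_lt_trans muoo.
  by apply: le_measure; rewrite ?inE.
by rewrite measureU// fineD//; exact: fin.
Qed.

Lemma finitely_additive_restr F D : measurable D -> finitely_additive F ->
  finitely_additive (fun A => F (A `&` D)).
Proof.
move=> mD aF A B mA mB AB; rewrite setIUl aF//; do ?exact: measurableI.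
by rewrite setIACA AB set0I.
Qed.

Lemma finitely_additiveZ (k : R) F : finitely_additive F ->
  finitely_additive (fun A => k * F A).
Proof. by move=> aF A B mA mB AB; rewrite aF// mulrDr. Qed.

Lemma finitely_additiveD F G : finitely_additive F -> finitely_additive G ->
  finitely_additive (fun A => F A + G A).
Proof. by move=> aF aG A B mA mB AB; rewrite aF// aG// addrACA. Qed.

Lemma finitely_additive_Rintegral mu (f : T -> R) :
  mu.-integrable setT (EFin \o f) ->
  finitely_additive (fun A => \int[mu]_(x in A) f x).
Proof.
move=> intf A B mA mB AB; rewrite Rintegral_setU//.
  2: by apply/disj_setPS; rewrite AB.
by apply: integrableS intf => //; exact: measurableU.
Qed.

Lemma finitely_additive_bigU (I : eqType) (s : seq I) (E : I -> set T) F :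
  finitely_additive F -> uniq s -> (forall i, measurable (E i)) ->
  trivIset setT E -> F (\big[setU/set0]_(i <- s) E i) = \sum_(i <- s) F (E i).
Proof.
move=> aF + mE tE; elim: s => [|i s IH] /=.
  have := aF set0 set0 measurable0 measurable0 (setI0 _).
  by rewrite !big_nil setU0; lra.
move=> /andP[nis us]; rewrite !big_cons aF ?IH//.
  exact: bigsetU_measurable.
rewrite big_distrr /= big_seq big1// => j js.
apply: (trivIsetP.1 tE) => //; apply: contraNneq nis => ->; exact: js.
Qed.

End additive_set_functions.

Section tree_martingales.
Context (m : nat) (R : realType).
Hypothesis hm : (1 < m)%N.

Lemma card_sons : #|{: sons m}| = (m ^ 2)%N.
Proof. by rewrite card_prod !card_ord Zp_cast. Qed.

(** The factor is the inverse of the uniform measure of the atom. *)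
Definition tree_density (F : set (pathspace m) -> R) (v : vertex m) : R :=
  (m ^ 2)%:R ^+ size v * F (atom v).

Lemma tree_density_martingale F : finitely_additive F ->
  tree_martingale (tree_density F).
Proof.
move=> aF v; rewrite card_sons /tree_density mulrA -exprS.
under eq_bigr do rewrite size_rcons.
rewrite -mulr_sumr.
rewrite -(finitely_additive_bigU
  (E := fun ij => atom (rcons v ij) : set (pathspace m)) aF)//.
- congr (_ * F _); rewrite atom_sons -bigcup_seq; congr bigcup.
  by apply/seteqP; split => // ij _ /=; rewrite mem_index_enum.
- exact: index_enum_uniq.
- by move=> i; exact: measurable_atom.
- exact: trivIset_sons.
Qed.

End tree_martingales.

(** * Atoms on which one measure is small relative to another *)

Section selection.
Context (m : nat) (R : realType).
Local Open Scope ereal_scope.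
Implicit Types (A G : set (pathspace m)).
Implicit Types (kappa tau : {measure set (pathspace m) -> \bar R}).

Lemma layer_bigcup G n : layer G n =
  \bigcup_(t in [set t : n.-tuple (sons m) | atom t `<=` G]) atom t.
Proof.
apply/seteqP; split => [x Gx|x [t tG]].
  have xn : size (path_vertex x n) == n by rewrite size_mkseq.
  by exists (Tuple xn) => //; exact: atom_path_vertex.
by rewrite /layer /= /atom /= size_tuple => ->.
Qed.

Lemma measure_layer tau G n : tau (layer G n) =
  \sum_(t \in [set t : n.-tuple (sons m) | atom t `<=` G]) tau (atom t).
Proof.
rewrite layer_bigcup measure_fin_bigcup//.
- exact: finite_finset.
- move=> t u _ _ [x [xt xu]]; apply: val_inj.
  by apply: (atom_eq _ xt xu); rewrite !size_tuple.
- by move=> t _; exact: measurable_atom.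
Qed.

Lemma layer_bigcap G A : tree_open G -> \bigcap_n (A `\` layer G n) = A `\` G.
Proof.
move=> oG; apply/seteqP; split => [x Ax|x [Ax nGx] n _].
  split; first by case: (Ax 0%N I).
  by move=> Gx; have [n xn] := tree_open_nbhs oG Gx; case: (Ax n I) => _; apply.
by split => // /layer_sub.
Qed.

Lemma setD_layer_homo G A : nonincreasing_seq (fun n => A `\` layer G n).
Proof.
move=> n k nk; apply/subsetPset => x [Ax nLx]; split => // Lx; apply: nLx.
exact: layer_homo nk _ Lx.
Qed.

(** An open cover of [A] of small [kappa]-measure has a layer carrying at least half of [tau A].
    This layer is a finite disjoint union of atoms; if all of them failed, summing would give it too
    much [kappa]-measure. *)
Lemma small_atom kappa tau A (e : R) : kappa setT < +oo -> tau setT < +oo ->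
  measurable A -> (0 < e)%R -> kappa A = 0 -> 0 < tau A ->
  exists v : vertex m,
    0 < tau (atom v) /\ kappa (atom v) <= e%:E * tau (atom v).
Proof.
move=> koo too mA e0 kA tA.
have fintA : tau A \is a fin_num.
  rewrite ge0_fin_numE//; apply: le_lt_trans too.
  by apply: le_measure; rewrite ?inE.
pose a := fine (tau A); have tAE : tau A = a%:E by rewrite fineK.
have a0 : (0 < a)%R by rewrite -lte_fin -tAE.
(* The layer will have [tau]-measure at least [a / 2], so [e * a / 4] stays strictly below [e] times
   that measure. *)
have [|G [oG AG Ge]] := tree_outer_regular koo (e := (e * a / 4)%R) mA _ kA.
  by rewrite divr_gt0 ?mulr_gt0.
have mG := measurable_tree_open oG.
have [n] : exists n, tau (G `\` layer G n) <= (a / 2)%:E.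
  apply: (nonincreasing_measure_le
    (F := fun n => G `\` layer G n) (e := 0)) => //.
  - by move=> n; apply: measurableD => //; exact: measurable_layer.
  - exact: setD_layer_homo.
  - by rewrite divr_gt0.
  - by rewrite layer_bigcap// setDv measure0.
have mL := measurable_layer G n.
move=> nle; have tL : (a / 2)%:E <= tau (layer G n).
  have : tau A <= tau (layer G n) + tau (G `\` layer G n).
    rewrite -measureU//; last by rewrite setDIK.
      by rewrite setDUK ?le_measure ?inE//; exact: layer_sub.
    exact: measurableD.
  rewrite tAE => h.
  have := le_trans h (leeD2l _ nle).
  rewrite -leeBlDr// -EFinB; apply: le_trans; rewrite lee_fin; lra.
apply: contrapT => /forallNP nv.
have : e%:E * tau (layer G n) <= kappa (layer G n).
  rewrite !measure_layer ge0_mule_fsumr//.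
  apply: lee_fsum => [|t _]; first exact: finite_finset.
  have /not_andP[] := nv t.
    move/negP; rewrite -leNgt measure_le0 => /eqP ->.
    by rewrite mule0.
  by move/negP; rewrite -ltNge => /ltW.
apply/negP; rewrite -ltNge.
have kL : kappa (layer G n) <= kappa G.
  by apply: le_measure; rewrite ?inE//; exact: layer_sub.
apply: le_lt_trans kL (le_lt_trans Ge _).
apply: lt_le_trans (lee_wpmul2l _ tL); last by rewrite lee_fin ltW.
rewrite -EFinM lte_fin; have := mulr_gt0 e0 a0; lra.
Qed.

End selection.

(** * Densities with respect to the total variation *)

Lemma mulmx22E (R : pzSemiRingType) (A B : 'M[R]_2) r s :
  (A *m B) r s = A r 0 * B 0 s + A r 1 * B 1 s.
Proof.
rewrite mxE !big_ord_recl big_ord0 addr0.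
by rewrite (_ : lift ord0 ord0 = 1)//; exact: val_inj.
Qed.

Lemma ReM (R : rcfType) (z w : R[i]) :
  complex.Re (z * w) =
  complex.Re z * complex.Re w - complex.Im z * complex.Im w.
Proof. by case: z w => [a b] [c d]. Qed.

Lemma Re_mulmx (R : rcfType) n (A B : 'M[R[i]]_n) r s :
  complex.Re ((A *m B) r s) = \sum_j (complex.Re (A r j) * complex.Re (B j s) -
    complex.Im (A r j) * complex.Im (B j s)).
Proof. by rewrite mxE raddf_sum; apply: eq_bigr => j _; rewrite /= ReM. Qed.

(** The l^1 norm of the eight real coordinates; it dominates the Euclidean norm and can be
    integrated entry by entry. *)
Definition entry_norm (R : realType) (A : 'M[R[i]]_2) : R :=
  \sum_i \sum_j (`|complex.Re (A i j)| + `|complex.Im (A i j)|).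

Lemma entry_norm_ge0 (R : realType) (A : 'M[R[i]]_2) : 0 <= entry_norm A.
Proof.
by apply: sumr_ge0 => i _; apply: sumr_ge0 => j _; exact: addr_ge0.
Qed.

Lemma euclid_norm_le_entry_norm (R : realType) (A : 'M[R[i]]_2) :
  euclid_norm A <= entry_norm A.
Proof.
have sum_sqr (I : finType) (a : I -> R) : (forall i, 0 <= a i) ->
    \sum_i a i ^+ 2 <= (\sum_i a i) ^+ 2.
  move=> a0; rewrite expr2 mulr_suml; apply: ler_sum => i _.
  by rewrite expr2 ler_wpM2l// (bigD1 i)//= lerDl sumr_ge0.
rewrite /euclid_norm -[leRHS]ger0_norm ?entry_norm_ge0//.
rewrite -sqrtr_sqr ler_wsqrtr//.
rewrite /entry_norm !pair_bigA.
apply: le_trans (sum_sqr _ _ _) => [|k]; last by rewrite addr_ge0.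
apply: ler_sum => k _; rewrite sqrrD !real_normK ?num_real//.
by rewrite lerD2r lerDl mulrn_wge0// mulr_ge0.
Qed.

Section weighted_measure.
Context d (T : measurableType d) (R : realType).
Context (mu : {measure set T -> \bar R}) (f : T -> \bar R).
Hypotheses (mf : measurable_fun [set: T] f) (f0 : forall x, (0 <= f x)%E).

(** The hypotheses on [f] are part of the term, so that the measure instance below can be inferred
    from it. *)
Definition weighted_measure (_ : measurable_fun [set: T] f)
    (_ : forall x, (0 <= f x)%E) := fun A => (\int[mu]_(x in A) f x)%E.

Local Notation wmu := (weighted_measure mf f0).

Let wmu0 : wmu set0 = 0%E. Proof. exact: integral_set0. Qed.

Let wmu_ge0 A : (0 <= wmu A)%E. Proof. exact: integral_ge0. Qed.

Let wmu_sigma_additive : semi_sigma_additive wmu.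
Proof. exact: semi_sigma_additive_nng_induced. Qed.

HB.instance Definition _ :=
  isMeasure.Build d T R wmu wmu0 wmu_ge0 wmu_sigma_additive.

End weighted_measure.

Lemma Rintegral_sum d (T : measurableType d) (R : realType)
    (mu : {measure set T -> \bar R}) (D : set T) (I : Type) (s : seq I)
    (f : I -> T -> R) : measurable D ->
  (forall i, mu.-integrable D (EFin \o f i)) ->
  \int[mu]_(x in D) (\sum_(i <- s) f i x) =
  \sum_(i <- s) \int[mu]_(x in D) f i x.
Proof.
move=> mD intf; have ints s' :
    mu.-integrable D (EFin \o (fun x => \sum_(i <- s') f i x)).
  apply: (eq_integrable mD (fun x => \sum_(i <- s') (f i x)%:E)%E) => [x _|].
    by rewrite /= sumEFin.
  by apply: integrable_sum => // i _; exact: intf.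
elim: s => [|i s IH].
  under eq_Rintegral do rewrite big_nil.
  by rewrite big_nil Rintegral_cst// mul0r.
under eq_Rintegral do rewrite big_cons.
by rewrite big_cons -IH RintegralD.
Qed.

Section density.
Context d (T : measurableType d) (R : realType).
Context (nu : mxmeasure T R) (h : T -> 'M[R[i]]_2).
Hypothesis hh : mxdensity nu (mxvariation nu) h.

Local Notation tau := (mxvariation nu).

Let Re_int i j : tau.-integrable setT (EFin \o (fun x => complex.Re (h x i j))).
Proof. by case: hh => /(_ i j)[]. Qed.

Let Im_int i j : tau.-integrable setT (EFin \o (fun x => complex.Im (h x i j))).
Proof. by case: hh => /(_ i j)[]. Qed.

Let integrable_fsum (I : finType) (f : I -> T -> R) :
  (forall i, tau.-integrable setT (EFin \o f i)) ->
  tau.-integrable setT (EFin \o (fun x => \sum_i f i x)).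
Proof.
move=> intf; apply: (eq_integrable _ (fun x => \sum_i (f i x)%:E)%E) => //.
  by move=> x _; rewrite /= sumEFin.
by apply: integrable_sum => // i _; exact: intf.
Qed.

Let integrable_norm (f : T -> R) : tau.-integrable setT (EFin \o f) ->
  tau.-integrable setT (EFin \o (fun x => `|f x|)).
Proof. move=> intf; exact: (integrable_abse intf). Qed.

Let integrable_entry i j : tau.-integrable setT
  (EFin \o (fun x => `|complex.Re (h x i j)| + `|complex.Im (h x i j)|)).
Proof.
apply: (integrableD measurableT (integrable_norm (Re_int i j))
  (integrable_norm (Im_int i j))).
Qed.

Let integrable_entry_norm :
  tau.-integrable setT (EFin \o (fun x => entry_norm (h x))).
Proof. by apply: integrable_fsum => i; apply: integrable_fsum => j. Qed.

(** On each piece of a disjoint sequence the coordinates of [nu] are integrals of those of [h]. The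
    bound yields both the finiteness of the total variation and the negligibility of the zeros of
    [h]. *)
Lemma mxvariation_le_integral A : measurable A ->
  (tau A <= \int[tau]_(x in A) (entry_norm (h x))%:E)%E.
Proof.
move=> mA; have db0 x : (0 <= (entry_norm (h x))%:E)%E.
  by rewrite lee_fin entry_norm_ge0.
have [mdb _] := integrableP _ _ _ integrable_entry_norm.
apply: ge_ereal_sup => _ [E [mE tE EA] <-].
apply: (@le_trans _ _
    (\sum_(0 <= k <oo) \int[tau]_(x in E k) (entry_norm (h x))%:E)%E).
  apply: lee_nneseries => [k _|k _]; first by rewrite lee_fin euclid_norm_ge0.
  have intE (f : T -> R) : tau.-integrable setT (EFin \o f) ->
      tau.-integrable (E k) (EFin \o f).
    by move=> intf; apply: integrableS intf.
  rewrite -(@fineK _ (\int[tau]_(x in E k) _)%E); last first.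
    by apply: integrable_fin_num => //; exact: intE.
  rewrite lee_fin (le_trans (euclid_norm_le_entry_norm _))//.
  rewrite -/(Rintegral _ _ _) Rintegral_sum//; last first.
    move=> i; apply: intE; apply: integrable_fsum => j.
    exact: integrable_entry.
  apply: ler_sum => i _; rewrite Rintegral_sum//; last first.
    by move=> j; apply: intE; exact: integrable_entry.
  apply: ler_sum => j _; rewrite RintegralD//;
    do ?[by apply: intE; exact: integrable_norm].
  have [-> ->] := hh.2 _ (mE k) i j.
  by apply: lerD; apply: le_normr_Rintegral => //; exact: intE.
rewrite -ge0_integral_bigcup//; last exact: measurable_funTS.
apply: ge0_subset_integral => //; first exact: bigcupT_measurable.
exact: measurable_funTS.
Qed.

Lemma mxvariation_lty : (tau setT < +oo)%E.
Proof.
apply: le_lt_trans (mxvariation_le_integral measurableT) _.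
have [mdb] := integrableP _ _ _ integrable_entry_norm; apply: le_lt_trans.
apply: ge0_le_integral => // [x _||x _]; last exact: lee_abs.
  by rewrite lee_fin entry_norm_ge0.
exact: measurableT_comp.
Qed.

Lemma negligible_zeros : tau.-negligible [set x | h x = 0].
Proof.
have [mdb _] := integrableP _ _ _ integrable_entry_norm.
have entry_norm0 x : h x = 0 -> entry_norm (h x) = 0.
  move=> ->; rewrite /entry_norm big1// => i _; rewrite big1// => j _.
  by rewrite mxE /= normr0 addr0.
have Z0 : [set x | h x = 0] = (fun x => (entry_norm (h x))%:E) @^-1` [set 0%E].
  apply/seteqP; split => [x /= /entry_norm0 ->//|x /= [hx]].
  apply/matrixP => i j; rewrite mxE; move/eqP: hx.
  rewrite psumr_eq0 => [|k _]; last by apply: sumr_ge0 => l _; exact: addr_ge0.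
  move=> /allP /(_ i (mem_index_enum _)).
  rewrite psumr_eq0 => [|l _]; last exact: addr_ge0.
  move=> /allP /(_ j (mem_index_enum _)) /=; rewrite paddr_eq0// !normr_eq0.
  by case: (h x i j) => u w /= /andP[/eqP -> /eqP ->].
have mZ : measurable [set x | h x = 0].
  by rewrite Z0 -[X in measurable X]setTI; exact: mdb.
apply/negligibleP => //; apply/eqP; rewrite -measure_le0.
apply: le_trans (mxvariation_le_integral mZ) _.
by rewrite integral0_eq// => x /= /entry_norm0 ->.
Qed.

Lemma integrable_Re_mulmx (b : 'M[R[i]]_2) (k : 'I_2 * 'I_2) :
  tau.-integrable setT (EFin \o (fun x => complex.Re ((b *m h x) k.1 k.2))).
Proof.
case: k => r s /=.
have intZ (a : R) (f : T -> R) : tau.-integrable setT (EFin \o f) ->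
    tau.-integrable setT (EFin \o (fun x => a * f x)).
  by move=> intf; apply: (integrableZl measurableT a intf).
apply: (eq_integrable measurableT (EFin \o (fun x => \sum_j
    (complex.Re (b r j) * complex.Re (h x j s) -
     complex.Im (b r j) * complex.Im (h x j s))))).
  by move=> x _ /=; rewrite Re_mulmx.
apply: integrable_fsum => j.
exact: (integrableB measurableT
  (intZ _ _ (Re_int j s)) (intZ _ _ (Im_int j s))).
Qed.

Lemma Rintegral_Re_mulmx (b : 'M[R[i]]_2) (k : 'I_2 * 'I_2) A : measurable A ->
  \int[tau]_(x in A) complex.Re ((b *m h x) k.1 k.2) =
  complex.Re ((b *m nu A) k.1 k.2).
Proof.
move=> mA; case: k => r s /=.
have intA (f : T -> R) : tau.-integrable setT (EFin \o f) ->
    tau.-integrable A (EFin \o f).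
  by move=> intf; apply: integrableS intf.
have intZ (a : R) (f : T -> R) : tau.-integrable setT (EFin \o f) ->
    tau.-integrable A (EFin \o (fun x => a * f x)).
  by move=> /intA intf; apply: (integrableZl mA a intf).
under eq_Rintegral do rewrite Re_mulmx.
rewrite Re_mulmx Rintegral_sum//.
  apply: eq_bigr => j _; have [-> ->] := hh.2 _ mA j s.
  by rewrite RintegralB ?RintegralZl//; do ?[exact: intZ|exact: intA].
move=> j.
exact: (integrableB mA (intZ _ _ (Re_int j s)) (intZ _ _ (Im_int j s))).
Qed.

End density.

(** * Densities close to the identity *)

(* The inverse is 4 M + 8, where M is the coefficient of r in supersolution_ge1
   for the constant C = 64 m^4 of gradient_error_bound. *)
Definition identity_radius (R : realType) (m : nat) : R :=
  (4 * (1 + 4 * (64 * m%:R ^+ 4) * #|{: 'I_2 * 'I_2}|%:R * #|{: sons m}|%:R)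
   + 8)^-1.

Lemma identity_radius_gt0 (R : realType) m : 0 < identity_radius R m.
Proof.
by rewrite invr_gt0 ltr_wpDl// mulr_ge0// addr_ge0// !mulr_ge0.
Qed.

Section near_identity.
Context (m : nat) (R : realType).
Hypothesis hm : (1 < m)%N.
Context (mu : {measure set (pathspace m) -> \bar R}).
Hypothesis hmu : uniform_measure mu.
Context (nu : mxmeasure (pathspace m) R).
Hypothesis hnu : Diff nu `<=` @discrete_gradients m R.
Context (h : pathspace m -> 'M[R[i]]_2).
Hypothesis hh : mxdensity nu (mxvariation nu) h.
Context (b : 'M[R[i]]_2).

Local Notation tau := (mxvariation nu).
Local Notation t := (fun B => fine (tau B)).
Implicit Types (A B G : set (pathspace m)) (k : 'I_2 * 'I_2).

Let C : R := 64 * m%:R ^+ 4.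
Let M : R := 1 + 4 * C * #|{: 'I_2 * 'I_2}|%:R * #|{: sons m}|%:R.
Let eps : R := identity_radius R m.

Let tau_lty : (tau setT < +oo)%E := mxvariation_lty hh.

(** The density, with respect to [tau], of an entry of the real part of [b nu] minus [tau] times the
    identity. *)
Definition deviation k (x : pathspace m) : R :=
  complex.Re ((b *m h x) k.1 k.2) - (k.1 == k.2)%:R.

Definition total_deviation x : R := \sum_k `|deviation k x|.

Let integrable_cst (a : R) : tau.-integrable setT (EFin \o cst a).
Proof.
apply/integrableP; split; first exact/measurable_EFinP/measurable_cst.
by rewrite (integral_cst tau measurableT (`|a|%:E)) lte_mul_pinfty// lee_fin.
Qed.

Let integrable_deviation k : tau.-integrable setT (EFin \o deviation k).
Proof.
exact: (integrableB measurableT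
  (integrable_Re_mulmx hh b k) (integrable_cst _)).
Qed.

Let integrable_total_deviation : tau.-integrable setT (EFin \o total_deviation).
Proof.
apply: (eq_integrable measurableT (fun x => \sum_k `|(deviation k x)%:E|)%E).
  by move=> x _ /=; rewrite -sumEFin.
apply: integrable_sum => // k _.
exact: integrable_abse (integrable_deviation k).
Qed.

Lemma measurable_near_identity e : measurable [set y | total_deviation y <= e].
Proof.
have [md _] := integrableP _ _ _ integrable_total_deviation.
rewrite (_ : mkset _ = setT `&`
    (EFin \o total_deviation) @^-1` [set` `]-oo, e%:E]]).
  by apply: md => //; exact: emeasurable_itv.
apply/seteqP; split => [y ye|y [_]]; last by rewrite /= in_itv /= lee_fin.
by split => //; rewrite /= in_itv /= lee_fin.
Qed.

Let integrableT_sub (f : pathspace m -> R) A : measurable A ->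
  tau.-integrable setT (EFin \o f) -> tau.-integrable A (EFin \o f).
Proof. by move=> mA intf; apply: integrableS intf. Qed.

Lemma Rintegral_deviation k A : measurable A ->
  \int[tau]_(x in A) deviation k x =
  complex.Re ((b *m nu A) k.1 k.2) - (k.1 == k.2)%:R * t A.
Proof.
move=> mA; rewrite RintegralB//.
- by rewrite (Rintegral_Re_mulmx hh)// Rintegral_cst.
- exact: integrableT_sub (integrable_Re_mulmx hh b k).
- exact: integrableT_sub (integrable_cst _).
Qed.

Let x (a : R) : vertex m -> R := tree_density (fun B => a * t B).

Let s (a : R) k : vertex m -> R :=
  tree_density (fun B => a * \int[tau]_(y in B) deviation k y).

Let finitely_additive_tau : finitely_additive t :=
  finitely_additive_fine tau_lty.

Let x_martingale a : tree_martingale (x a).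
Proof. exact/(tree_density_martingale hm)/finitely_additiveZ. Qed.

(** Left multiplication by [b] recombines the potentials [f] and [g], so [b] times a difference of
    [nu] is again a gradient. Up to the factor [a], its real part is the increment of [x] times the
    identity plus the increments of the [s k], as [gradient_error_bound] requires. *)
Lemma deviation_gradient (a : R) (v : vertex m) :
  \sum_p (x a (rcons v p) - x a v) ^+ 2 <=
  C * \sum_k \sum_p (s a k (rcons v p) - s a k v) ^+ 2.
Proof.
have [f [g fg]] : discrete_gradients (difference nu v) by apply: hnu; exists v.
pose F (r : 'I_2) i j := a * complex.Re (b r 0 * f i j + b r 1 * g i j).
have key k p : (k.1 == k.2)%:R * (x a (rcons v p) - x a v) +
    (s a k (rcons v p) - s a k v) =
    a * complex.Re ((b *m difference nu v p) k.1 k.2).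
  rewrite /x /s /tree_density !Rintegral_deviation; do ?exact: measurable_atom.
  rewrite /difference /atom_value mulmxBr -!scalemxAr.
  have ReB (D E : 'M[R[i]]_2) i j :
      complex.Re ((D - E) i j) = complex.Re (D i j) - complex.Re (E i j).
    by rewrite !mxE; case: (D i j) (E i j) => [? ?] [? ?].
  have ReZ n (D : 'M[R[i]]_2) i j :
      complex.Re (((m ^ 2)%:R ^+ n *: D) i j) =
      (m ^ 2)%:R ^+ n * complex.Re (D i j).
    by rewrite mxE -!natrX !mulr_natl raddfMn.
  rewrite ReB !ReZ; ring.
apply: (gradient_error_bound (F := F)) => //.
- apply/eqP; rewrite sumrB subr_eq0 sumr_const -[X in _ == X]mulr_natl.
  exact/eqP/x_martingale.
- move=> r i j; have := key (r, 0) (i, j); rewrite /= => ->.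
  rewrite fg mulmx22E !mxE /= /F -mulrBr -raddfB.
  congr (a * complex.Re _); ring.
- move=> r i j; have := key (r, 1) (i, j); rewrite /= => ->.
  rewrite fg mulmx22E !mxE /= /F -mulrBr -raddfB.
  congr (a * complex.Re _); ring.
Qed.

Let total_deviation_ge0 y : 0 <= total_deviation y.
Proof. by apply: sumr_ge0. Qed.

Let muT : mu setT = 1%E.
Proof.
by have := hmu [::]; rewrite /= expr0 invr1 => <-; congr (mu _); apply/seteqP.
Qed.

Let eps0 : 0 < eps := identity_radius_gt0 R m.

Let t_le A B : measurable A -> measurable B -> A `<=` B -> t A <= t B.
Proof.
move=> mA mB AB; rewrite fine_le ?le_measure ?inE// ge0_fin_numE//.
  by apply: le_lt_trans tau_lty; rewrite le_measure ?inE.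
by apply: le_lt_trans tau_lty; rewrite le_measure ?inE.
Qed.

Lemma near_identity_atom A : measurable A ->
  (forall y, A y -> total_deviation y <= eps) -> (0 < tau A)%E ->
  exists v : vertex m, [/\ 0 < t (atom v),
    t (atom v `\` A) <= eps * t (atom v) &
    \int[tau]_(y in atom v) total_deviation y <= 2 * eps * t (atom v)].
Proof.
move=> mA Aeps tA.
pose f y := 1 + total_deviation y.
have intf : tau.-integrable setT (EFin \o f).
  exact: (integrableD measurableT
    (integrable_cst 1) integrable_total_deviation).
have [mf foo] := integrableP _ _ _ intf.
have f0 y : (0 <= (EFin \o f) y)%E by rewrite lee_fin addr_ge0.
(* kappa A = 0 makes both tau (. \ A) and the deviation off A small. *)
pose kappa := mrestr (weighted_measure tau mf f0) (measurableC mA).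
have kappaE B : measurable B ->
    kappa B = (\int[tau]_(y in B `\` A) f y)%:E.
  move=> mB; rewrite /kappa /mrestr /weighted_measure /Rintegral fineK//.
  apply: integrable_fin_num; first exact: measurableD.
  by apply: integrableT_sub => //; exact: measurableD.
have koo : (kappa setT < +oo)%E by rewrite kappaE// ltry.
have kA : kappa A = 0%E by rewrite kappaE// setDv Rintegral_set0.
have [v [tv kv]] := small_atom koo tau_lty mA eps0 kA tA.
exists v; move: tv kv.
have : measurable (atom v : set (pathspace m)) := measurable_atom v.
move: (atom v : set (pathspace m)) => V mV tV kV.
have {kV} : (kappa V <= eps%:E * tau V)%E := kV.
have tVE : tau V = (t V)%:E.
  rewrite fineK// ge0_fin_numE//.
  by apply: le_lt_trans tau_lty; rewrite le_measure ?inE.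
rewrite [X in (_ * X)%E]tVE kappaE// -EFinM lee_fin => kV.
have mVA : measurable (V `\` A) by exact: measurableD.
have mVA' : measurable (V `&` A) by exact: measurableI.
have tVA : t (V `\` A) = \int[tau]_(y in V `\` A) 1.
  by rewrite Rintegral_cst// mul1r.
have f1 : \int[tau]_(y in V `\` A) f y =
    t (V `\` A) + \int[tau]_(y in V `\` A) total_deviation y.
  rewrite tVA -RintegralD//; last exact: integrableT_sub.
  exact: integrableT_sub (integrable_cst 1).
have d0 : 0 <= \int[tau]_(y in V `\` A) total_deviation y.
  exact: Rintegral_ge0.
split.
- by rewrite -lte_fin -tVE.
- by apply: le_trans kV; rewrite f1 lerDl.
- rewrite -[X in \int[tau]_(y in X) _](setUIDK V A) Rintegral_setU//.
  (* On [A] the deviation is at most [eps] pointwise, and off [A] its integral is part of [kappa V];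
     each contributes one [eps * t V]. *)
  + apply: (@le_trans _ _ (eps * t (V `&` A) +
        \int[tau]_(y in V `\` A) total_deviation y)).
      rewrite lerD2r -Rintegral_cst//; apply: le_Rintegral => //.
      * exact: integrableT_sub.
      * by apply: integrableT_sub => //; exact: integrable_cst.
      * by move=> y [_ /Aeps].
    rewrite mulr2n mulrDl mul1r mulrDl lerD//.
      by rewrite ler_wpM2l// ?(ltW eps0)// t_le.
    by apply: le_trans kV; rewrite f1 lerDr fine_ge0.
  + by apply: integrableT_sub => //; exact: measurableU.
  + by apply/disj_setPS => y [[_ ?] [_ ?]].
Qed.

Let tauE A : measurable A -> tau A = (t A)%:E.
Proof.
move=> mA; rewrite fineK// ge0_fin_numE//.
by apply: le_lt_trans tau_lty; rewrite le_measure ?inE.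
Qed.

Let total_density (a : R) : vertex m -> R :=
  tree_density (fun B => a * \int[tau]_(y in B) total_deviation y).

Let norm_s_le a k v : 0 <= a -> `|s a k v| <= total_density a v.
Proof.
have mv := measurable_atom v.
move=> a0; rewrite /s /total_density /tree_density !normrM.
rewrite ger0_norm ?exprn_ge0// (ger0_norm a0) ler_wpM2l ?exprn_ge0//.
rewrite ler_wpM2l// (le_trans (le_normr_Rintegral _ _))//.
  exact: integrableT_sub (integrable_deviation k).
apply: le_Rintegral => //.
- apply: integrableT_sub => //.
  exact: (integrable_abse (integrable_deviation k)).
- exact: integrableT_sub.
- by move=> y _; rewrite /total_deviation (bigD1 k)//= lerDl sumr_ge0.
Qed.

(* Its value at an atom of generation N bounds 1 whenever x a > 1/2 there, since
   the atom is either contained in L = layer G N or disjoint from it. *)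
Let mixed_density (a : R) (L : set (pathspace m)) : vertex m -> R :=
  tree_density (fun B => 2 * a * t (B `&` ~` L) + fine (mu (B `&` L))).

Let mixed_density_ge1 a G w : 0 <= a -> 1 / 2 < x a w ->
  1 <= mixed_density a (layer G (size w)) w.
Proof.
move=> a0; rewrite /x /mixed_density /tree_density => xw.
have q0 : 0 < ((m ^ 2)%:R : R) by rewrite ltr0n expn_gt0 (ltnW hm).
(* Inside the layer the [mu] part is exactly 1; outside it the [tau] part is [2 * x a w]. *)
have [wL|wL] := atom_layer G w.
  rewrite [X in mu X](_ : _ = atom w); last exact/setIidl.
  rewrite hmu /= mulrDr mulfV ?gt_eqF ?exprn_gt0// lerDr.
  by rewrite !mulr_ge0 ?exprn_ge0 ?fine_ge0.
rewrite [X in tau X](_ : _ = atom w); last exact/setIidl/disjoints_subset.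
rewrite mulrDr; apply: ler_wpDr.
  by rewrite mulr_ge0 ?exprn_ge0 ?fine_ge0.
by rewrite -mulrA mulrCA -ler_pdivrMl// ltW// mulrC.
Qed.

Let C_ge0 : 0 <= C.
Proof. by rewrite mulr_ge0// exprn_ge0. Qed.

Let sons_gt0 : (0 < #|{: sons m}|)%N.
Proof. by rewrite card_sons// expn_gt0 (ltnW hm). Qed.

Let eps_le : 2 * eps <= 1.
Proof.
have M0 : 0 <= M by rewrite addr_ge0// !mulr_ge0.
rewrite (_ : eps = (4 * M + 8)^-1)// ler_pdivrMr; lra.
Qed.

Let s_martingale a k : tree_martingale (s a k).
Proof.
apply/(tree_density_martingale hm)/finitely_additiveZ.
exact: (finitely_additive_Rintegral (integrable_deviation k)).
Qed.

Let total_martingale a : tree_martingale (total_density a).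
Proof.
apply/(tree_density_martingale hm)/finitely_additiveZ.
exact: (finitely_additive_Rintegral integrable_total_deviation).
Qed.

Let mixed_martingale a L : measurable L -> tree_martingale (mixed_density a L).
Proof.
move=> mL; apply/(tree_density_martingale hm)/finitely_additiveD.
  apply/finitely_additiveZ; apply: (finitely_additive_restr (F := t)) => //.
  exact: measurableC.
apply: (finitely_additive_restr (F := fun B => fine (mu B))) => //.
by apply: finitely_additive_fine; rewrite muT ltry.
Qed.

Let mixed_density_ge0 a L w : 0 <= a -> 0 <= mixed_density a L w.
Proof.
move=> a0; rewrite /mixed_density /tree_density.
by rewrite !(mulr_ge0, addr_ge0) ?exprn_ge0 ?fine_ge0.
Qed.

Let total_density_ge0 a w : 0 <= a -> 0 <= total_density a w.
Proof.
move=> a0; rewrite /total_density /tree_density.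
by rewrite !mulr_ge0 ?exprn_ge0//; exact: Rintegral_ge0.
Qed.

(** As [(4 * M + 8) * eps = 1], the terms in [r] and [y] add up to at most
    [(2 * M + 4) * eps + 1 / 4], which is 3/4. *)
Let final_bound (S r y : R) : 0 <= S -> r <= 2 * eps ->
  y <= 2 * (2 * eps) + 1 / 4 -> 4 * (0 - C * S) + M * r + y < 1.
Proof.
have M0 : 0 <= M by rewrite addr_ge0// !mulr_ge0.
have : (4 * M + 8) * eps = 1 by rewrite mulfV// gt_eqF// ltr_wpDl// mulr_ge0.
by move=> + /(mulr_ge0 C_ge0) + /(ler_wpM2l M0); lra.
Qed.

Lemma near_identity_null A : measurable A -> mu A = 0%E ->
  (forall y, A y -> total_deviation y <= eps) -> tau A = 0%E.
Proof.
move=> mA muA Aeps; apply/eqP/negPn/negP => tA.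
have {}tA : (0 < tau A)%E by rewrite lt0e tA mxvariation_ge0.
have [v [c0 vA vd]] := near_identity_atom mA Aeps tA.
set c := t (atom v) in c0 vA vd.
have mv : measurable (atom v : set (pathspace m)) := measurable_atom v.
pose q : R := (m ^ 2)%:R.
have q1 : 1 <= q by rewrite ler1n expn_gt0 (ltnW hm).
have q0 : 0 < q by apply: lt_le_trans q1.
pose n0 := size v.
have mu_lty : (mu setT < +oo)%E by rewrite muT ltry.
(* A quarter of the [mu]-measure of [atom v]; it becomes the [1 / 4] of [yv]. *)
have e0 : 0 < q ^- n0 / 4 by rewrite divr_gt0// invr_gt0 exprn_gt0.
have [G [oG AG muG]] := tree_outer_regular mu_lty mA e0 muA.
have mG : measurable G by exact: measurable_tree_open.
have mD n : measurable ((atom v : set (pathspace m)) `\` layer G n).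
  by apply: measurableD => //; exact: measurable_layer.
(* The sets decrease to [atom v] minus [G], which lies in [atom v] minus [A]; doubling [eps * c]
   provides the strict inequality needed to stop at a finite generation. *)
have [] := @nonincreasing_measure_le _ _ _ tau
    (fun n => (atom v : set (pathspace m)) `\` layer G n)
    (eps * c) (2 * eps * c) tau_lty mD (@setD_layer_homo _ _ _).
- by rewrite -mulrA ltr_pMl ?mulr_gt0// ltr1n.
- rewrite layer_bigcap// (@le_trans _ _ (t (atom v `\` A))%:E)//.
  rewrite -tauE; last exact: measurableD.
  by apply: le_measure; rewrite ?inE//; [exact: measurableD..|exact: setDS].
move=> N0 N0le.
(* [N] is at least [n0] so that [supersolution_ge1] applies at [v]. *)
pose N := maxn n0 N0; pose L := layer G N.
have mL : measurable L by exact: measurable_layer.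
have vL : t (atom v `\` L) <= 2 * eps * c.
  have : (tau (atom v `\` L) <= (2 * eps * c)%:E)%E.
    apply: le_trans N0le; apply: le_measure; rewrite ?inE; do ?exact: mD.
    by apply: setDS; apply: layer_homo; rewrite /N leq_maxr.
  by rewrite tauE ?lee_fin//; exact: mD.
(* This scaling makes [x a v] equal to 1, so that the term [(x a v - 1) ^+ 2] vanishes. *)
pose a := (q ^+ n0 * c)^-1.
have a0 : 0 <= a by rewrite invr_ge0 mulr_ge0 ?exprn_ge0// ltW.
have qn0 : 0 < q ^+ n0 by rewrite exprn_gt0.
have qa u : q ^+ n0 * (a * u) = u / c.
  by rewrite /a invfM !mulrA mulfV ?gt_eqF// mul1r mulrC.
have xv : x a v = 1 by rewrite /x /tree_density qa divff ?gt_eqF.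
have rv : total_density a v <= 2 * eps.
  by rewrite /total_density /tree_density qa ler_pdivrMr.
have yv : mixed_density a L v <= 2 * (2 * eps) + 1 / 4.
  rewrite /mixed_density /tree_density -/q -/n0 mulrDr lerD//.
    by rewrite -mulrA mulrCA qa ler_pM2l// ler_pdivrMr.
  rewrite -ler_pdivlMl// mul1r -lee_fin (le_trans _ muG)//.
  rewrite fineK; last first.
    rewrite ge0_fin_numE//; apply: le_lt_trans mu_lty.
    by apply: le_measure; rewrite ?inE//; exact: measurableI.
  apply: le_measure; rewrite ?inE//; first exact: measurableI.
  by move=> z [_]; exact: layer_sub.
have rq : total_density a v <= #|{: sons m}|%:R.
  by rewrite card_sons// (le_trans rv)// (le_trans eps_le).
have := @supersolution_ge1 R (sons m) ('I_2 * 'I_2)%type C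
  (x a) (total_density a) (mixed_density a L) (s a) N
  C_ge0 sons_gt0 (x_martingale a) (total_martingale a)
  (mixed_martingale a mL) (s_martingale a) (fun w => mixed_density_ge0 L w a0)
  (fun k w => norm_s_le k w a0) (deviation_gradient a)
  (fun w => total_density_ge0 w a0).
have xy w : size w = N -> 1 / 2 < x a w -> 1 <= mixed_density a L w.
  by rewrite /L => <-; exact: mixed_density_ge1.
have S0 : 0 <= \sum_k s a k v ^+ 2 by apply: sumr_ge0 => k _; exact: sqr_ge0.
move=> /(_ xy v (leq_maxl _ _) rq); rewrite xv subrr expr0n /=.
by move=> /le_lt_trans /(_ (final_bound S0 rv yv)); rewrite ltxx.
Qed.

End near_identity.

(** * Rank of the density on the singular part *)

Lemma eq_mxvariation d (T : measurableType d) (R : realType)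
    (nu1 nu2 : mxmeasure T R) A :
  (forall B, measurable B -> B `<=` A -> nu1 B = nu2 B) ->
  mxvariation nu1 A = mxvariation nu2 A.
Proof.
move=> nu12; congr ereal_sup; apply/seteqP; split => _ [E [mE tE EA] <-];
  exists E => //; apply: eq_eseriesr => k _; rewrite nu12//;
  exact: subset_trans (bigcup_sup _) EA.
Qed.

(** A countable family of candidates for [b], which keeps the exceptional set a countable union. *)
Definition rat_mx (R : realType) (p : 'M[rat]_2 * 'M[rat]_2) : 'M[R[i]]_2 :=
  \matrix_(r, s) Complex (ratr (p.1 r s)) (ratr (p.2 r s)).

Lemma rat_approx (R : realType) (u e : R) : 0 < e ->
  exists q : rat, `|ratr q - u| <= e.
Proof.
move=> e0; have /rat_in_itvoo[q] : u - e < u + e by lra.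
by rewrite in_itv /= => /andP[? ?]; exists q; rewrite ler_norml; lra.
Qed.

Lemma rat_mx_approx (R : realType) (b : 'M[R[i]]_2) (e : R) : 0 < e ->
  exists p, forall r s, `|complex.Re ((rat_mx R p - b) r s)| <= e /\
                        `|complex.Im ((rat_mx R p - b) r s)| <= e.
Proof.
move=> e0.
pose f r s := cid (rat_approx (complex.Re (b r s)) e0).
pose g r s := cid (rat_approx (complex.Im (b r s)) e0).
exists (\matrix_(r, s) sval (f r s), \matrix_(r, s) sval (g r s)) => r s.
have subE (z w : R[i]) : complex.Re (z - w) = complex.Re z - complex.Re w /\
    complex.Im (z - w) = complex.Im z - complex.Im w by case: z w => ? ? [].
by rewrite !mxE !(subE _ _).1 !(subE _ _).2; split;
  [exact: (svalP (f r s))|exact: (svalP (g r s))].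
Qed.

(** If [p] approximates the inverse of [h], then [p h - I] is the small error times [h]. *)
Lemma unitmx_near_identity (R : realType) (h : 'M[R[i]]_2) (e : R) :
  0 < e -> h \in unitmx ->
  exists p, \sum_(k : 'I_2 * 'I_2)
    `|complex.Re ((rat_mx R p *m h) k.1 k.2) - (k.1 == k.2)%:R| <= e.
Proof.
(* The 4 counts the matrix entries; adding 1 keeps the denominator positive. *)
move=> e0 hU; pose d := e / (4 * (entry_norm h + 1)).
have K0 : 0 < 4 * (entry_norm h + 1).
  by rewrite mulr_gt0// ltr_wpDl// entry_norm_ge0.
have d0 : 0 < d by rewrite divr_gt0.
have [p pd] := rat_mx_approx (invmx h) d0; exists p.
have dK : 4 * (d * entry_norm h) <= e.
  rewrite /d mulrCA mulrA -mulrA -[leRHS]mulr1 -mulrA ler_pM2l// mulrC.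
  by rewrite ler_pdivrMr// mul1r ler_pM2l// lerDl.
apply: le_trans dK.
rewrite (_ : 4 * _ = \sum_(k : 'I_2 * 'I_2) d * entry_norm h); last first.
  by rewrite sumr_const card_prod !card_ord mulr_natl.
apply: ler_sum => -[r s] _ /=.
have -> : rat_mx R p = (rat_mx R p - invmx h) + invmx h by rewrite subrK.
rewrite mulmxDl mulVmx// [X in complex.Re X]mxE raddfD /=.
rewrite [X in _ + complex.Re X]mxE.
rewrite (_ : complex.Re (_%:R) = (r == s)%:R); last by case: eqP.
rewrite addrK Re_mulmx (le_trans (ler_norm_sum _ _ _))// /entry_norm mulr_sumr.
apply: ler_sum => j _; rewrite mulr_sumr.
apply: (@le_trans _ _ (d * (`|complex.Re (h j s)| + `|complex.Im (h j s)|))).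
  rewrite (le_trans (ler_normB _ _))// !normrM mulrDr lerD// ler_wpM2r//.
    by case: (pd r j).
  by case: (pd r j).
rewrite (bigD1 s)//= lerDl sumr_ge0// => l _.
by rewrite mulr_ge0 ?addr_ge0// ltW.
Qed.

Lemma rank22_neq1 (F : fieldType) (A : 'M[F]_2) :
  \rank A <> 1%N -> A = 0 \/ A \in unitmx.
Proof.
move=> rA; have [->|A0] := eqVneq A 0; [by left|right].
rewrite -row_free_unit /row_free eqn_leq rank_leq_row /=.
by move: A0; rewrite -mxrank_eq0; case: (\rank A) rA => [|[|]].
Qed.

Theorem corollary12 (R : realType) (m : nat) (hm : (2 <= m)%N)
    (mu : {measure set (pathspace m) -> \bar R}) (hmu : uniform_measure mu)
    (nu : mxmeasure (pathspace m) R)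
    (hnu : Diff nu `<=` @discrete_gradients m R)
    (nu_s : mxmeasure (pathspace m) R) (hnu_s : singular_part mu nu nu_s)
    (h : pathspace m -> 'M[R[i]]_2)
    (hh : mxdensity nu (mxvariation nu) h) :
  {ae mxvariation nu_s, forall x, \rank (h x) = 1%N}.
Proof.
have [nu_a [nuE nu_a0 [N [mN muN nu_sN]]]] := hnu_s.
(* [nu_a] vanishes on measurable subsets of the null set [N], so [nu_s] and [nu] have the same
   variation there. *)
have nu_s_null A : measurable A -> A `<=` N -> mxvariation nu A = 0%E ->
    (mxvariation nu_s).-negligible A.
  move=> mA AN A0; apply/negligibleP => //; rewrite -[RHS]A0.
  apply: eq_mxvariation => B mB BA; rewrite nuE// nu_a0 ?add0r//.
  apply/eqP; rewrite -measure_le0 -muN le_measure ?inE//.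
  exact: subset_trans AN.
pose near p : set (pathspace m) :=
  N `&` [set x | total_deviation h (rat_mx R p) x <= identity_radius R m].
have near0 p : (mxvariation nu_s).-negligible (near p).
  have mp : measurable (near p).
    by apply: measurableI => //; exact: measurable_near_identity hh _ _.
  apply: nu_s_null => //; first exact: subIsetl.
  apply: (near_identity_null hm hmu hnu hh (b := rat_mx R p)) => //.
    apply/eqP; rewrite -measure_le0 -muN le_measure ?inE//.
    exact: subIsetl.
  by move=> x [].
have [Z [mZ Z0 hZ]] := negligible_zeros hh.
have NZ0 : (mxvariation nu_s).-negligible (N `&` Z).
  have mNZ : measurable (N `&` Z) by exact: measurableI.
  apply: nu_s_null => //.
  by apply/eqP; rewrite -measure_le0 -Z0 le_measure ?inE//.
have NC0 : (mxvariation nu_s).-negligible (~` N).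
  by apply/negligibleP; [exact: measurableC|exact: nu_sN].
(* The rational matrices are enumerated by their codes; a code of no matrix contributes the empty
   set. *)
pose nearn n := if unpickle n is Some p then near p else set0.
have nearn0 n : (mxvariation nu_s).-negligible (nearn n).
  rewrite /nearn; case: unpickle => [p|]; first exact: near0.
  exact: negligible_set0.
apply: negligibleS
  (negligibleU NC0 (negligibleU NZ0 (negligible_bigcup nearn0))).
move=> x /= /rank22_neq1 hx; have [Nx|Nx] := pselect (N x); [right|by left].
have [/hZ Zx|/(unitmx_near_identity (identity_radius_gt0 R m))[p xp]] := hx.
  by left.
by right; exists (pickle p) => //; rewrite /nearn pickleK.
Qed.
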